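(* Let $d\ge2$ and $n\ge1$ be integers. For any universal $n$-qudit circuit consisting of SUM gates and single-qudit gates, the number of SUM gates in the circuit is at least $$\Big\lceil\frac{1}{2d(d-1)}\big[d^{2n}-n(d^2-1)-1\big]\Big\rceil .$$ The same lower bound holds for the number of CINC gates in any universal $n$-qudit circuit consisting of CINC gates and single-qudit gates.
   Context: $\mathcal{H}_{d}$ is a $d$-dimensional complex Hilbert space with orthonormal (computational) basis $|0\rangle,\dots,|d-1\rangle$ (a qudit). $X_d=|0\rangle\langle d-1|+\sum_{a=0}^{d-2}|a+1\rangle\langle a|$. A SUM gate on $n$ qudits is, for some $i\neq j$, the unitary that applies $X_d^{x_i}$ to the $j$-th tensor factor of each computational basis vector $|x_1\dots x_n\rangle$. A CINC gate is, for some $i\ne j$, the unitary that applies $X_d$ to the $j$-th tensor factor of $|x_1\dots x_n\rangle$ if $x_i=d-1$ and acts as the identity otherwise. A single-qudit gate is an arbitrary unitary on $\mathcal{H}_d$ acting on one tensor factor. Consider an $n$-qudit circuit (finite sequence of gates) consisting of SUM (or CINC) gates and single-qudit gates, where the positions of all gates are fixed but the single-qudit gate placed at each single-qudit position can be varied arbitrarily. If every unitary operator on $\mathcal{H}_d^{\otimes n}$ can be implemented by the circuit by varying the single-qudit gates, the circuit is called a universal $n$-qudit circuit. *)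

(* Defs.v *)
From HB Require Import structures.
From mathcomp Require Import all_boot all_order all_algebra.
From mathcomp Require Import reals complex.

Set Implicit Arguments.
Unset Strict Implicit.
Unset Printing Implicit Defensive.

Import Order.TTheory GRing.Theory Num.Theory.
Local Open Scope ring_scope.

(* Operators are matrices acting on column vectors: the entry (x, y) of A is
   <x|A|y>.  The computational basis of the n-fold tensor power of a
   d-dimensional space is indexed by words x : {ffun 'I_n -> 'I_d}, where x i
   is the label x_i of the factor i; [ket] decodes a matrix index. *)
Notation qdim d n := #|{ffun 'I_n -> 'I_d}|.

Definition ket (d n : nat) (x : 'I_(qdim d n)) : {ffun 'I_n -> 'I_d} :=
  enum_val x.

Section Operators.
Variables (C : numClosedFieldType) (d n : nat).

Definition tensor_op (A : 'I_n -> 'M[C]_d) : 'M[C]_(qdim d n) :=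
  \matrix_(x, y) \prod_(k < n) A k (ket x k) (ket y k).

Definition on_factor (i : 'I_n) (A : 'M[C]_d) : 'M[C]_(qdim d n) :=
  tensor_op (fun k => if k == i then A else 1%:M).

(* ordS is the successor modulo d: X_d |b> = |b + 1 mod d> *)
Definition shift_op : 'M[C]_d := \matrix_(a, b) (a == ordS b)%:R.

(* In the two gates below, column y is the image of the basis vector |y>. *)
Definition sum_gate (i j : 'I_n) : 'M[C]_(qdim d n) :=
  \matrix_(x, y) on_factor j (shift_op ^+ (ket y i)) x y.

Definition cinc_gate (i j : 'I_n) : 'M[C]_(qdim d n) :=
  \matrix_(x, y)
    (if ket y i == d.-1 :> nat then on_factor j shift_op else 1%:M) x y.

End Operators.

(* A circuit records only the positions of its gates, in order of application *)
Inductive slot (n : nat) : Type :=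
| Single (i : 'I_n)
| TwoQudit (i j : 'I_n) of i != j.

Definition circuit (n : nat) := seq (slot n).

Definition is_two_qudit (n : nat) (s : slot n) : bool :=
  if s is TwoQudit _ _ _ then true else false.

Section Circuits.
Variables (C : numClosedFieldType) (d n : nat).

(* The gate put at each two-qudit position, typically sum_gate or cinc_gate *)
Variable G : 'I_n -> 'I_n -> 'M[C]_(qdim d n).

Definition slot_op (A : 'M[C]_d) (s : slot n) : 'M[C]_(qdim d n) :=
  match s with
  | Single i => on_factor i A
  | TwoQudit i j _ => G i j
  end.

(* V k is the single-qudit gate placed at position k of the circuit; it is
   ignored when position k carries a two-qudit gate or is past the end *)
Fixpoint circuit_op (c : circuit n) (V : nat -> 'M[C]_d) : 'M[C]_(qdim d n) :=
  if c is s :: c' then circuit_op c' (fun k => V k.+1) *m slot_op (V 0%N) s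
  else 1%:M.

Definition universal_circuit (c : circuit n) : Prop :=
  forall U : 'M[C]_(qdim d n), U \is unitarymx ->
  exists V : nat -> 'M[C]_d,
    (forall k, V k \is unitarymx) /\ circuit_op c V = U.

End Circuits.

Definition two_qudit_count (n : nat) (c : circuit n) : nat :=
  count (@is_two_qudit n) c.

(* Main.v *)
(* Dimension count by metric entropy, at scale 1/q with q large.  The unitary
   group of dimension N = d^n contains about q^(N^2) unitaries at mutual distance
   1/q (Cayley transforms of a grid of Hermitian matrices).  On the other hand,
   let T be a torus of unitaries diagonal in a fixed basis; U(d) modulo T is
   covered by about q^(d^2 - d) cosets.  A diagonal unitary on the control of a
   two-qudit gate, and a unitary commuting with X_d on its target, can be moved
   past the gate, so each two-qudit gate contributes only 2 (d^2 - d) to the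
   exponent.  The local unitaries that remain contribute n (d^2 - 1) + 1, because
   they may be taken modulo phases on all factors but one. *)
Require Import Defs.
From HB Require Import structures.
From mathcomp Require Import all_boot all_order all_algebra.
From mathcomp Require Import boolp reals complex.
From mathcomp Require Import ring lra zify.

Set Implicit Arguments.
Unset Strict Implicit.
Unset Printing Implicit Defensive.

Import Order.TTheory GRing.Theory Num.Theory.
Local Open Scope ring_scope.
Local Open Scope sesquilinear_scope.

(** * The entrywise l1 norm of complex matrices *)

Section L1Norm.
Variable C : numClosedFieldType.

Definition l1norm m n (A : 'M[C]_(m, n)) : C := \sum_i \sum_j `|A i j|.

Lemma l1norm_ge0 m n (A : 'M[C]_(m, n)) : 0 <= l1norm A.
Proof. by apply: sumr_ge0 => i _; apply: sumr_ge0. Qed.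

Lemma l1normD m n (A B : 'M[C]_(m, n)) : l1norm (A + B) <= l1norm A + l1norm B.
Proof.
rewrite /l1norm -big_split /=; apply: ler_sum => i _.
by rewrite -big_split /=; apply: ler_sum => j _; rewrite mxE ler_normD.
Qed.

Lemma l1normN m n (A : 'M[C]_(m, n)) : l1norm (- A) = l1norm A.
Proof. by apply: eq_bigr => i _; apply: eq_bigr => j _; rewrite mxE normrN. Qed.

Lemma l1normB m n (A B : 'M[C]_(m, n)) : l1norm (A - B) = l1norm (B - A).
Proof. by rewrite -l1normN opprB. Qed.

Lemma l1normZ m n a (A : 'M[C]_(m, n)) : l1norm (a *: A) = `|a| * l1norm A.
Proof.
rewrite /l1norm mulr_sumr; apply: eq_bigr => i _; rewrite mulr_sumr.
by apply: eq_bigr => j _; rewrite mxE normrM.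
Qed.

Lemma l1norm_adj m n (A : 'M[C]_(m, n)) : l1norm (A ^t*) = l1norm A.
Proof.
rewrite /l1norm exchange_big; apply: eq_bigr => i _; apply: eq_bigr => j _.
by rewrite !mxE norm_conjC.
Qed.

Lemma le_norm_l1norm m n (A : 'M[C]_(m, n)) i j : `|A i j| <= l1norm A.
Proof.
rewrite /l1norm (bigD1 i) //= (bigD1 j) //= -addrA lerDl addr_ge0 //.
  by apply: sumr_ge0.
by apply: sumr_ge0 => k _; apply: sumr_ge0.
Qed.

Lemma l1normM m n p (A : 'M[C]_(m, n)) (B : 'M[C]_(n, p)) :
  l1norm (A *m B) <= l1norm A * l1norm B.
Proof.
rewrite /l1norm mulr_suml; apply: ler_sum => i _.
apply: (@le_trans _ _ (\sum_j \sum_k `|A i k| * `|B k j|)).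
  apply: ler_sum => j _; rewrite mxE; apply: le_trans (ler_norm_sum _ _ _) _.
  by apply: ler_sum => k _; rewrite normrM.
rewrite exchange_big mulr_suml /=; apply: ler_sum => k _.
rewrite -mulr_sumr ler_wpM2l //.
by rewrite (bigD1 k) //= lerDl; apply: sumr_ge0 => l _; apply: sumr_ge0.
Qed.

Lemma l1norm_le_entries m n (A : 'M[C]_(m, n)) (b : C) :
  (forall i j, `|A i j| <= b) -> l1norm A <= (m * n)%:R * b.
Proof.
move=> Ab; apply: (@le_trans _ _ (\sum_(i < m) \sum_(j < n) b)).
  by apply: ler_sum => i _; apply: ler_sum.
by rewrite !sumr_const !card_ord -mulrnA mulr_natl mulnC.
Qed.

Lemma norm_unitary_entry n (U : 'M[C]_n) i j : U \is unitarymx -> `|U i j| <= 1.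
Proof.
move=> /unitarymxP/matrixP/(_ i i); rewrite !mxE eqxx.
rewrite (bigD1 j) //= !mxE -normCK => e.
rewrite -(@ler_pXn2r _ 2) ?nnegrE // expr1n -[leRHS]e lerDl.
by apply: sumr_ge0 => k _; rewrite !mxE -normCK exprn_ge0.
Qed.

Lemma l1norm_unitary n (U : 'M[C]_n) : U \is unitarymx -> l1norm U <= (n * n)%:R.
Proof.
by move=> hU; rewrite -[leRHS]mulr1; apply: l1norm_le_entries => i j;
   apply: norm_unitary_entry.
Qed.

Lemma l1norm1 n : l1norm (1%:M : 'M[C]_n) = n%:R.
Proof.
rewrite /l1norm -[n in RHS]card_ord -sum1_card natr_sum; apply: eq_bigr => i _.
rewrite (bigD1 i) //= big1 ?mxE ?eqxx ?normr1 ?addr0 // => j ji.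
by rewrite !mxE eq_sym (negbTE ji) normr0.
Qed.

Lemma le_half_normr_eq0 (x : C) : 0 <= x -> x <= x / 2 -> x = 0.
Proof.
move=> x0 hx; apply: le_anti; rewrite x0 andbT -subr_ge0.
have -> : 0 - x = 2 * (x / 2 - x) by field.
by rewrite mulr_ge0 // subr_ge0.
Qed.

Lemma unitary_adj n (U : 'M[C]_n) : U \is unitarymx -> U^t* *m U = 1%:M.
Proof. by move=> hU; apply/mulmx1C/unitarymxP. Qed.

Lemma trmxCM m n p (A : 'M[C]_(m, n)) (B : 'M[C]_(n, p)) :
  (A *m B)^t* = B^t* *m A^t*.
Proof. by rewrite trmx_mul map_mxM. Qed.

Lemma trmxCD m n (A B : 'M[C]_(m, n)) : (A + B)^t* = A^t* + B^t*.
Proof. by apply/matrixP => i j; rewrite !mxE rmorphD. Qed.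

Lemma trmxCB m n (A B : 'M[C]_(m, n)) : (A - B)^t* = A^t* - B^t*.
Proof. by apply/matrixP => i j; rewrite !mxE rmorphB. Qed.

Lemma trmxC1 n : (1%:M : 'M[C]_n)^t* = 1%:M.
Proof. by rewrite trmx1 map_mx1. Qed.

Lemma unitarymx1 n : (1%:M : 'M[C]_n) \is unitarymx.
Proof. by apply/unitarymxP; rewrite trmxC1 mulmx1. Qed.

Lemma natr_dist_lt1 (a b : nat) : `|a%:R - b%:R : C| < 1 -> a = b.
Proof.
have aux (x y : nat) : (x <= y)%N -> `|x%:R - y%:R : C| < 1 -> x = y.
  move=> xy; rewrite distrC -natrB // normr_nat (ltr_nat _ _ 1).
  by move: xy; lia.
case: (leqP a b) => [|/ltnW] ab; first exact: aux.
by rewrite distrC => /(aux _ _ ab).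
Qed.

End L1Norm.

(** * A grid of small Hermitian matrices *)

Section HermitianGrid.
Variables (C : numClosedFieldType) (D q : nat).
Hypothesis q_gt0 : (0 < q)%N.

(* The factor 8 (D + 1)^2 bounds the l1norm by 1/2. *)
Definition herm_grid (c : {ffun 'I_D * 'I_D -> 'I_q}) : 'M[C]_D :=
  \matrix_(i, j) (((c (i, j))%:R + (c (j, i))%:R
                   + 'i * ((c (i, j))%:R - (c (j, i))%:R))
                  / (8 * D.+1 * D.+1 * q)%:R).

Lemma herm_grid_adj c : (herm_grid c)^t* = herm_grid c.
Proof.
apply/matrixP => i j; rewrite !mxE.
rewrite (rmorphM Num.conj) fmorphV rmorph_nat !rmorphD (rmorphM Num.conj 'i).
rewrite rmorphB !rmorph_nat /= conjCi.
by congr (_ * _); ring.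
Qed.

Lemma herm_grid_le c : l1norm (herm_grid c) <= 2^-1.
Proof.
have le_q (x : 'I_q) : `|x%:R : C| <= q%:R by rewrite normr_nat ler_nat ltnW.
have s0 : 0 < (8 * D.+1 * D.+1 * q)%:R :> C by rewrite ltr0n !muln_gt0 q_gt0.
apply: le_trans (l1norm_le_entries (b := 4 * q%:R / (8 * D.+1 * D.+1 * q)%:R) _) _.
  move=> i j; rewrite mxE normf_div normr_nat ler_pM2r ?invr_gt0 //.
  have -> : 4 * q%:R = (q%:R + q%:R) + 1 * (q%:R + q%:R) :> C by ring.
  apply: le_trans (ler_normD _ _) _; apply: lerD.
    by apply: le_trans (ler_normD _ _) _; apply: lerD.
  by rewrite normrM normCi !mul1r; apply: le_trans (ler_normB _ _) _; apply: lerD.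
rewrite mulrA ler_pdivrMr // [leRHS]mulrC ler_pdivlMr // -!natrM ler_nat.
by nia.
Qed.

(** Up to the common denominator, the (i, j) entry has the integers c(i,j) + c(j,i) and c(i,j) -
    c(j,i) as real and imaginary parts. Integers at distance less than 1 agree, and the sum and the
    difference determine c(i,j). *)
Lemma herm_grid_inj c c' :
  l1norm (herm_grid c - herm_grid c') < (8 * D.+1 * D.+1 * q)%:R^-1 -> c = c'.
Proof.
move=> lt_cc'; apply/ffunP => -[i j].
have s0 : 0 < (8 * D.+1 * D.+1 * q)%:R :> C by rewrite ltr0n !muln_gt0 q_gt0.
have /le_lt_trans/(_ lt_cc') :=
  le_norm_l1norm (herm_grid c - herm_grid c') i j.
rewrite !mxE -mulrBl normf_div normr_nat -[ltRHS]mul1r ltr_pM2r ?invr_gt0 //.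
set z := (X in `|X|) => z1.
have natR (x : nat) : (x%:R : C) \is Num.real by [].
(* The terms of the imaginary part are regrouped in [b] and [b'] so that only sums of natural
   numbers are compared. *)
pose a := (c (i, j) + c (j, i))%N; pose a' := (c' (i, j) + c' (j, i))%N.
pose b := (c (i, j) + c' (j, i))%N; pose b' := (c (j, i) + c' (i, j))%N.
have zE : z = (a%:R - a'%:R) + 'i * (b%:R - b'%:R).
  by rewrite /z /a /a' /b /b' !natrD; ring.
have aR : (a%:R - a'%:R : C) \is Num.real by rewrite rpredB.
have bR : (b%:R - b'%:R : C) \is Num.real by rewrite rpredB.
have ea : a = a'.
  apply: natr_dist_lt1; apply: le_lt_trans z1.
  have -> : a%:R - a'%:R = 'Re z by rewrite zE Re_rect.
  exact: (leif_normC_Re_Creal z).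
have eb : b = b'.
  apply: natr_dist_lt1; apply: le_lt_trans z1.
  have -> : b%:R - b'%:R = - 'Re ('i * z).
    have -> : 'i * z = - (b%:R - b'%:R) + 'i * (a%:R - a'%:R).
      by rewrite zE mulrDr mulrA -expr2 sqrCi mulN1r addrC.
    by rewrite Re_rect ?opprK // rpredN.
  rewrite normrN -[leRHS]mul1r -(normCi C) -normrM.
  exact: (leif_normC_Re_Creal ('i * z)).
by apply: val_inj; move: ea eb; rewrite /a /a' /b /b' /=; lia.
Qed.

End HermitianGrid.

(** * The Cayley transform from Hermitian to unitary matrices *)

Section Cayley.
Variables (C : numClosedFieldType) (D : nat).
Implicit Type H : 'M[C]_D.

Definition cayley H := (1%:M + 'i *: H) *m invmx (1%:M - 'i *: H).

(** A row v in the kernel satisfies v = v (iH), so its norm is at most half of itself. *)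
Lemma cayley_unit H : l1norm H <= 2^-1 -> 1%:M - 'i *: H \in unitmx.
Proof.
move=> H2; rewrite -row_free_unit; apply/row_freeP.
suff /row_freeP [B hB] : row_free (1%:M - 'i *: H) by exists B.
apply: inj_row_free => v; rewrite mulmxBr mulmx1 => /subr0_eq hv.
have v0 : l1norm v = 0.
  apply: le_half_normr_eq0; first exact: l1norm_ge0.
  rewrite {1}hv -scalemxAr l1normZ normCi mul1r.
  apply: le_trans (l1normM _ _) _; apply: ler_wpM2l => //; exact: l1norm_ge0.
apply/matrixP => i j; rewrite mxE; apply/normr0_eq0/le_anti.
by rewrite normr_ge0 andbT -v0 le_norm_l1norm.
Qed.

(** For Hermitian H the numerator 1 + iH is the adjoint of the denominator M = 1 - iH, and the two
    commute. *)
Lemma cayley_unitary H : H^t* = H -> l1norm H <= 2^-1 -> cayley H \is unitarymx.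
Proof.
move=> Hh H2; have u := cayley_unit H2; set M := _ - _ in u.
have Mt : M^t* = 1%:M + 'i *: H.
  rewrite /M trmxCB trmxC1; congr (_ + _); apply/matrixP => i j.
  by rewrite -[in RHS]Hh !mxE rmorphM /= conjCi mulNr opprK.
have MC : M *m M^t* = M^t* *m M.
  rewrite Mt /M; set K := 'i *: H.
  rewrite [LHS]mulmxBl [RHS]mulmxDl !mul1mx mulmxDr mulmxBr !mulmx1.
  by rewrite opprD addrA addrK [RHS]addrA subrK.
rewrite /cayley -/M -Mt; apply/unitarymxP.
rewrite trmxCM -mulmxA; set N := invmx M.
have NM : N *m M = 1%:M by rewrite mulVmx.
have NtMt : M^t* *m N^t* = 1%:M by rewrite -trmxCM NM trmxC1.
have -> : (M^t*)^t* = M by rewrite trmxCK.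
have h : N^t* *m M^t* = 1%:M by apply: mulmx1C.
have -> : N^t* *m M = M *m N^t*.
  rewrite -[LHS]mulmx1 -NtMt mulmxA -(mulmxA (N^t*) M) MC (mulmxA (N^t*)) h.
  by rewrite mul1mx.
by rewrite (mulmxA N) NM mul1mx.
Qed.

(** With M = 1 - iH and M' = 1 - iH', the transform of H is 2 M^-1 - 1. Hence M (cayley H - cayley
    H') M' = 2 (M' - M) = 2i (H - H'), where M and M' have norm at most D + 1. *)
Lemma cayley_expansive H H' : l1norm H <= 2^-1 -> l1norm H' <= 2^-1 ->
  l1norm (H - H') <= (D.+1 * D.+1)%:R * l1norm (cayley H - cayley H').
Proof.
move=> h h'; have u := cayley_unit h; have u' := cayley_unit h'.
have bnd (K : 'M[C]_D) : l1norm K <= 2^-1 -> l1norm (1%:M - 'i *: K) <= D.+1%:R.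
  move=> hK; apply: le_trans (l1normD _ _) _.
  rewrite l1normN l1normZ normCi mul1r l1norm1 -natr1 lerD2l.
  by apply: le_trans hK _; rewrite invf_le1 ?ler1n.
have cE (K : 'M[C]_D) : 1%:M - 'i *: K \in unitmx ->
    cayley K = 2 *: invmx (1%:M - 'i *: K) - 1%:M.
  rewrite /cayley; set M := 1%:M - _ => uK.
  have -> : 1%:M + 'i *: K = 2%:R *: 1%:M - M.
    by rewrite scaler_nat mulr2n opprB addrA addrAC addrK.
  by rewrite mulmxBl mulmxV // -scalemxAl mul1mx.
have key : H - H' = (2^-1 * - 'i) *: ((1%:M - 'i *: H) *m
             (cayley H - cayley H') *m (1%:M - 'i *: H')).
  rewrite (cE _ u) (cE _ u') opprB addrA subrK -scalerBr -scalemxAr -scalemxAl.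
  have -> : H - H' = 'i *: ((1%:M - 'i *: H) - (1%:M - 'i *: H')).
    rewrite opprB [X in _ *: X]addrC addrA subrK -scalerBr scalerA -expr2 sqrCi scaleN1r.
    by rewrite opprB.
  set M := 1%:M - 'i *: H in u *; set M' := 1%:M - 'i *: H' in u' *.
  rewrite (mulmxBr M (invmx M)) mulmxBl mulmxV // mul1mx -mulmxA mulVmx // mulmx1 scalerA.
  by rewrite mulrAC mulVf ?pnatr_eq0 // mul1r scaleNr -scalerN [X in _ = _ *: X]opprB.
rewrite {1}key l1normZ normrM normrN normCi mulr1 normfV normr_nat.
set X := _ *m _ *m _; apply: (@le_trans _ _ (l1norm X)).
  by rewrite ler_piMl ?l1norm_ge0 // invf_le1 ?ler1n.
apply: le_trans (l1normM _ _) _.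
rewrite natrM mulrAC; apply: ler_pM; rewrite ?l1norm_ge0 ?bnd //.
by apply: le_trans (l1normM _ _) _; apply: ler_wpM2r; rewrite ?l1norm_ge0 ?bnd.
Qed.

End Cayley.

(** * Pigeonhole bound for separated families of matrices *)

Section Packing.
Variable R : realType.

Lemma real_cells (B m : nat) : (0 < m)%N ->
  exists f : R -> 'I_(2 * B * m).+1, forall x y,
    `|x| <= B%:R -> `|y| <= B%:R -> f x = f y -> `|x - y| <= m%:R^-1.
Proof.
move=> m0.
pose g (x : R) : int := Num.floor (x * m%:R) + (B * m)%:Z.
have m0R : (0 : R) < m%:R by rewrite ltr0n.
have gP x : `|x| <= B%:R -> 0 <= g x <= (2 * B * m)%:Z.
  rewrite ler_norml => /andP[lx ux]; apply/andP; split; rewrite /g.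
    rewrite -lerBlDr sub0r floor_ge_int rmorphN /= -pmulrn natrM.
    by rewrite -mulNr ler_pM2r.
  have : Num.floor (x * m%:R) <= (B * m)%:Z.
    rewrite -(ler_int R) -pmulrn; apply: le_trans (floor_le _) _.
    by rewrite natrM ler_pM2r.
  lia.
(* On [-B, B] the shifted floor lies between 0 and 2 B m, so there neither the absolute value nor
   the default value of [inord] changes it. *)
exists (fun x => inord `|g x|%N) => x y /gP/andP[gx gx'] /gP/andP[gy gy'] e.
have gE : g x = g y.
  move/(congr1 val): e; rewrite /= !inordK; lia.
have {}gE : Num.floor (x * m%:R) = Num.floor (y * m%:R).
  by move: gE; rewrite /g => /addIr.
rewrite -(ler_pM2r m0R) mulVf ?gt_eqF // -{1}(ger0_norm (ltW m0R)) -normrM mulrBl.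
have := floor_le (x * m%:R); have := floorD1_gt (x * m%:R).
have := floor_le (y * m%:R); have := floorD1_gt (y * m%:R).
rewrite gE; set k := Num.floor _; rewrite intrD => *.
rewrite ler_norml; lra.
Qed.

(** The boolean selects a real coordinate: [true] gives Re x, and [false] gives Re (i x) = - Im x.
    Each contributes an error 1/m. *)
Lemma complex_cells (B m : nat) : (0 < m)%N ->
  exists f : bool -> R[i] -> 'I_(2 * B * m).+1, forall x y,
    `|x| <= B%:R -> `|y| <= B%:R -> (forall b, f b x = f b y) ->
    `|x - y| <= 2 / m%:R.
Proof.
move=> m0; have [g gP] := real_cells B m0.
exists (fun b x => g (if b then complex.Re x else complex.Re ('i%C * x))).
have bnd (x : R[i]) : `|x| <= B%:R -> `|complex.Re x| <= B%:R.
  by move=> hx; rewrite -lecR rmorph_nat; apply: le_trans hx; apply: normc_ge_Re.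
have i1 : `|'i%C : R[i]| = 1 by rewrite normc_def /= expr0n expr1n add0r sqrtr1.
have bndi (x : R[i]) : `|x| <= B%:R -> `|complex.Re ('i%C * x)| <= B%:R.
  by move=> hx; apply: bnd; rewrite normrM i1 mul1r.
move=> x y hx hy e.
have e1 := gP _ _ (bnd _ hx) (bnd _ hy) (e true).
have e2 := gP _ _ (bndi _ hx) (bndi _ hy) (e false).
have castn (r : R) : `|r| <= m%:R^-1 -> `|r%:C%C| <= m%:R^-1 :> R[i].
  by rewrite -lecR fmorphV rmorph_nat normc_def /= expr0n addr0 sqrtr_sqr.
rewrite (complexE (x - y)).
have -> : 2 / m%:R = m%:R^-1 + m%:R^-1 :> R[i] by rewrite mulr_natl.
apply: le_trans (ler_normD _ _) _; apply: lerD.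
  by apply: castn; move: e1; case: (x) (y) => [? ?] [? ?].
rewrite normrM i1 mul1r; apply: castn; move: e2.
case: (x) (y) => [a b] [a' b'] /=; rewrite !mul0r !mul1r !sub0r -opprD normrN.
by [].
Qed.

Lemma packing_upper_bound (d B : nat) : exists K : nat,
  forall q, (0 < q)%N -> forall (I : finType) (A : I -> 'M[R[i]]_d),
  (forall i, l1norm (A i) <= B%:R) ->
  (forall i j, l1norm (A i - A j) <= q%:R^-1 -> i = j) ->
  (#|I| <= K * q ^ (2 * (d * d)))%N.
Proof.
(* Two matrices with all entries in the same cells of side 1/(k q) differ by at most d^2 * 2/(k q)
   in norm, and this choice of k makes that at most 1/q. *)
pose k := (2 * (d * d).+1)%N.
exists ((2 * B * k).+1 ^ (2 * (d * d)))%N => q q0 I A AB sep.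
have m0 : (0 < k * q)%N by rewrite muln_gt0 q0.
have [f fP] := complex_cells B m0.
pose F i := [ffun z : bool * ('I_d * 'I_d) => f z.1 (A i z.2.1 z.2.2)].
have Finj : injective F.
  move=> i j /ffunP e; apply: sep.
  apply: le_trans (l1norm_le_entries (b := 2 / (k * q)%:R) _) _.
    move=> u v; rewrite !mxE; apply: fP.
    - by apply: le_trans (AB i); apply: le_norm_l1norm.
    - by apply: le_trans (AB j); apply: le_norm_l1norm.
    by move=> b; have := e (b, (u, v)); rewrite !ffunE.
  have q0C : (0 : R[i]) < q%:R by rewrite ltr0n.
  have d0C : (0 : R[i]) < (d * d).+1%:R by rewrite ltr0n.
  rewrite /k; set N := (d * d)%N in d0C *.
  have -> : N%:R * (2 / (2 * N.+1 * q)%:R) = (N%:R / N.+1%:R) / q%:R :> R[i].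
    rewrite (natrM _ (2 * _)) (natrM _ 2).
    move: (N%:R) (N.+1%:R) (q%:R) d0C q0C => a b c b0 c0.
    by field; rewrite !gt_eqF.
  rewrite ler_piMl ?invr_ge0 ?ler0n // ler_pdivrMr // mul1r ler_nat.
  exact: leqnSn.
have := leq_card _ Finj; rewrite card_ffun !card_prod card_bool !card_ord.
move/leq_trans; apply; rewrite -expnMn; case: (posnP (2 * (d * d))) => [->|p0] //.
by rewrite leq_exp2r //; nia.
Qed.

End Packing.

(** * Metric dimension from below and from above *)

Section Entropy.
Variables (C : numClosedFieldType) (D : nat).
Implicit Types (S H : 'M[C]_D -> Prop) (q e : nat).

(** The metric dimension of H is at least [#|J|]: it contains q^[#|J|] points separated at a scale
    of order 1/q. The coordinates are indexed by a finite type so that product grids need no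
    enumeration. *)
Definition packs (J : finType) H := exists K : nat, forall q, (0 < q)%N ->
  exists t : {ffun J -> 'I_q} -> 'M[C]_D,
    (forall b, H (t b)) /\
    (forall b b', l1norm (t b - t b') <= (K.+1 * q)%:R^-1 -> b = b').

(* The metric dimension of S modulo right multiplication by H is at most e. *)
Definition covers e S H := exists K : nat, forall q, (0 < q)%N ->
  exists s : seq 'M[C]_D,
    [/\ (size s <= K * q ^ e)%N,
        (forall W, W \in s -> l1norm W <= K%:R)
      & forall X, S X -> exists W h,
          [/\ W \in s, H h & l1norm (X - W *m h) <= K%:R / q%:R]].

Definition unitary (U : 'M[C]_D) : Prop := U \is unitarymx.

Lemma packs_unitary : packs ('I_D * 'I_D)%type unitary.
Proof.
(* One factor (D + 1)^2 is the loss in [cayley_expansive], and 8 (D + 1)^2 is the scale of the grid.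
   The successor in [packs] provides the strict inequality of [herm_grid_inj]. *)
exists (8 * D.+1 * D.+1 * D.+1 * D.+1)%N => q q0.
exists (fun c => cayley (herm_grid C c)); split=> [c|c c' cc'].
  by apply: cayley_unitary; rewrite ?herm_grid_adj ?herm_grid_le.
apply/(herm_grid_inj (C := C) q0); apply: le_lt_trans (cayley_expansive _ _) _;
  rewrite ?herm_grid_le //.
apply: le_lt_trans (_ : (D.+1 * D.+1)%:R * _ < _); first exact: ler_wpM2l cc'.
rewrite mulrC -ltr_pdivlMr ?ltr0n ?muln_gt0 // -invfM -natrM.
rewrite ltf_pV2 ?posrE ?ltr0n ?muln_gt0 ?q0 // ltr_nat.
rewrite (_ : _ * _ = 8 * D.+1 * D.+1 * D.+1 * D.+1 * q)%N; last by ring.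
by rewrite ltn_pmul2r.
Qed.

End Entropy.

(** * Separated points on the unit circle *)

Section UnitCircle.
Variables (C : numClosedFieldType) (q : nat).
Hypothesis q_gt0 : (0 < q)%N.

(** The scalar Cayley transform of the real number a / q. *)
Definition circle_pt (a : nat) : C :=
  (1 + 'i * (a%:R / q%:R)) / (1 - 'i * (a%:R / q%:R)).

Let den_norm a : `|1 - 'i * (a%:R / q%:R)| = `|1 + 'i * (a%:R / q%:R)| :> C.
Proof.
rewrite -norm_conjC rmorphB rmorphM /= conjCi rmorph1 mulNr opprK.
by rewrite fmorph_div /= !rmorph_nat.
Qed.

Let den_neq0 a : 1 - 'i * (a%:R / q%:R) != 0 :> C.
Proof.
have rR : (a%:R / q%:R : C) \is Num.real by rewrite rpred_div ?realn.
rewrite -normr_gt0; apply: lt_le_trans (ltr01) _.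
have /le_trans := leif_normC_Re_Creal (1 - 'i * (a%:R / q%:R) : C).
by rewrite -mulrN Re_rect ?rpredN // normr1; apply.
Qed.

Lemma circle_pt_norm a : `|circle_pt a| = 1.
Proof. by rewrite normf_div -den_norm divff // normr_eq0. Qed.

(** Scalar form of the identity behind [cayley_expansive]. Both denominators have modulus at most 2,
    which bounds the distance between the integers a and b by 1/2. *)
Lemma circle_pt_inj (a b : 'I_q) :
  `|circle_pt a - circle_pt b| <= (4 * q)%:R^-1 -> a = b.
Proof.
move=> ab; apply/val_inj/(@natr_dist_lt1 C).
have q0 : (0 : C) < q%:R by rewrite ltr0n.
have den_le (c : 'I_q) : `|1 - 'i * (c%:R / q%:R)| <= 2 :> C.
  have -> : 2 = 1 + 1 :> C by rewrite -mulr2n.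
  apply: le_trans (ler_normB _ _) _; rewrite normr1 lerD2l normrM normCi mul1r.
  by rewrite normf_div !normr_nat ler_pdivrMr // mul1r ler_nat ltnW.
have key : a%:R - b%:R = (2 * 'i)^-1 * q%:R * ((1 - 'i * (a%:R / q%:R)) *
    (circle_pt a - circle_pt b) * (1 - 'i * (b%:R / q%:R))) :> C.
  rewrite -{1}(divfK (lt0r_neq0 q0) a%:R) -{1}(divfK (lt0r_neq0 q0) b%:R).
  rewrite /circle_pt; move: (den_neq0 a) (den_neq0 b).
  move: (a%:R / q%:R) (b%:R / q%:R) => x y x0 y0; field.
  by rewrite neq0Ci x0 y0.
rewrite /= key normrM [X in _ * X]normrM [X in _ * (X * _)]normrM.
rewrite normrM normfV normrM normCi mulr1 !normr_nat.
apply: (@le_lt_trans _ _ (2^-1 * q%:R * (2 * (4 * q)%:R^-1 * 2))).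
  by do !(apply: ler_pM; rewrite ?mulr_ge0 ?invr_ge0 ?ler0n ?normr_ge0).
rewrite natrM.
have -> : 2^-1 * q%:R * (2 * (4 * q%:R)^-1 * 2) = 2^-1 :> C.
  by field; rewrite gt_eqF.
by rewrite invf_lt1 ?ltr1n.
Qed.

End UnitCircle.

(** If no separated list were a net, each could be prolonged by a point far from all its terms,
    giving separated lists of every length against the bound. Separation is asked only from earlier
    to later terms, since [near] may fail to be symmetric and points are appended at the end. *)
Lemma maximal_separated (T : eqType) (x0 : T) (P : T -> Prop)
    (near : T -> T -> Prop) (B : nat) :
  (forall s : seq T, (forall x, x \in s -> P x) ->
     (forall i j, (i < j < size s)%N -> ~ near (nth x0 s i) (nth x0 s j)) ->
     (size s <= B)%N) ->
  exists s : seq T, [/\ (size s <= B)%N, (forall x, x \in s -> P x)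
    & forall x, P x -> exists2 y, y \in s & near y x].
Proof.
move=> bound.
pose sep s := (forall x, x \in s -> P x) /\
  (forall i j, (i < j < size s)%N -> ~ near (nth x0 s i) (nth x0 s j)).
case: (EM (exists2 s, sep s & forall x, P x -> exists2 y, y \in s & near y x)).
  by move=> [s [Ps sep_s] cov]; exists s; split=> //; apply: bound.
move=> no_net; suff /(_ B.+1) [s [Ps sep_s] sz] :
    forall k, exists2 s, sep s & size s = k.
  by have := bound s Ps sep_s; rewrite sz ltnn.
elim=> [|k [s [Ps sep_s] sz]]; first by exists [::] => //; split=> // i j; rewrite andbF.
have [x [Px far]] : exists x, P x /\ forall y, y \in s -> ~ near y x.
  apply: contrapT => h; apply: no_net; exists s => // x Px.
  apply: contrapT => h'; apply: h; exists x; split=> // y ys nyx.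
  by apply: h'; exists y.
exists (rcons s x); last by rewrite size_rcons sz.
split=> [y|i j]; first by rewrite mem_rcons inE => /orP[/eqP->|/Ps].
rewrite size_rcons ltnS => /andP[ij]; rewrite leq_eqVlt => /orP[/eqP ej|js].
  rewrite !nth_rcons ej ltnn eqxx -ej ij; apply: far.
  by rewrite mem_nth // -ej.
by rewrite !nth_rcons js (ltn_trans ij js); apply: sep_s; rewrite ij.
Qed.

(** * Nets of the unitary group modulo a subgroup *)

Section SubgroupNet.
Variables (R : realType) (D : nat).
Local Notation C := R[i].

(* Q (1 + H) determines H through its Gram matrix (1 + H)^2. *)
Lemma polar_separation (Q Q' H H' : 'M[C]_D) (e : C) :
  Q \is unitarymx -> Q' \is unitarymx -> H^t* = H -> H'^t* = H' ->
  l1norm H <= 2^-1 -> l1norm H' <= 2^-1 ->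
  l1norm (Q *m (1%:M + H) - Q' *m (1%:M + H')) <= e ->
  l1norm (H - H') <= (2 * (D * D * D.+1))%:R * e.
Proof.
move=> uQ uQ' Hh Hh' H2 H2' le_e.
have bndP (K : 'M[C]_D) : l1norm K <= 2^-1 -> l1norm (1%:M + K) <= D.+1%:R.
  move=> hK; apply: le_trans (l1normD _ _) _; rewrite l1norm1 -natr1 lerD2l.
  by apply: le_trans hK _; rewrite invf_le1 ?ler1n.
have bndA (U K : 'M[C]_D) : U \is unitarymx -> l1norm K <= 2^-1 ->
    l1norm (U *m (1%:M + K)) <= (D * D * D.+1)%:R.
  move=> uU hK; apply: le_trans (l1normM _ _) _; rewrite natrM.
  by apply: ler_pM; rewrite ?l1norm_ge0 ?l1norm_unitary ?bndP.
have sqE (U K : 'M[C]_D) : U \is unitarymx -> K^t* = K ->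
    (U *m (1%:M + K))^t* *m (U *m (1%:M + K)) = (1%:M + K) *m (1%:M + K).
  move=> uU hK; rewrite trmxCM trmxCD trmxC1 hK -mulmxA (mulmxA (U^t*)).
  by rewrite unitary_adj // mul1mx.
set A := Q *m _ in le_e; set A' := Q' *m _ in le_e.
have le_sq : l1norm (A^t* *m A - A'^t* *m A') <= (2 * (D * D * D.+1))%:R * e.
  have -> : A^t* *m A - A'^t* *m A' = A^t* *m (A - A') + (A - A')^t* *m A'.
    by rewrite mulmxBr trmxCB mulmxBl addrA subrK.
  apply: le_trans (l1normD _ _) _.
  rewrite mul2n -addnn natrD mulrDl; apply: lerD.
    apply: le_trans (l1normM _ _) _; rewrite l1norm_adj.
    by apply: ler_pM; rewrite ?l1norm_ge0 ?bndA.
  apply: le_trans (l1normM _ _) _; rewrite l1norm_adj mulrC.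
  by apply: ler_pM; rewrite ?l1norm_ge0 ?bndA.
(* The linear part of (1 + H)^2 - (1 + H')^2 is 2 (H - H'). The quadratic part has norm at most that
   of H - H', because H and H' have norm at most 1/2, so it is absorbed by one half of the left
   side. *)
have key : 2 *: (H - H') =
    (A^t* *m A - A'^t* *m A') - (H *m (H - H') + (H - H') *m H').
  rewrite /A /A' !sqE // !(mulmxDl, mulmxDr, mulmxN, mulNmx) !mulmx1 !mul1mx.
  move: (H *m H) (H *m H') (H' *m H') => HH HH' H'H'.
  by apply/matrixP => i j; rewrite !mxE; ring.
have : 2 * l1norm (H - H') <= (2 * (D * D * D.+1))%:R * e + l1norm (H - H').
  have {1}-> : 2 = `|2| :> C by rewrite normr_nat.
  rewrite -l1normZ key; apply: le_trans (l1normD _ _) _; rewrite l1normN.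
  apply: lerD => //; apply: le_trans (l1normD _ _) _.
  have -> : l1norm (H - H') = 2^-1 * l1norm (H - H') + l1norm (H - H') * 2^-1.
    by field.
  by apply: lerD; apply: le_trans (l1normM _ _) _;
     [apply: ler_wpM2r | apply: ler_wpM2l]; rewrite ?l1norm_ge0.
by rewrite mulr_natl mulr2n lerD2r.
Qed.

(** Right multiplication by 1 + H shrinks norms at most by a factor 2, because H has norm at most
    1/2. *)
Lemma unitary_separation (Q Q' H : 'M[C]_D) (e : C) :
  l1norm H <= 2^-1 -> l1norm (Q *m (1%:M + H) - Q' *m (1%:M + H)) <= e ->
  l1norm (Q - Q') <= 2 * e.
Proof.
move=> H2 le_e.
have : 2 * l1norm (Q - Q') <= 2 * (e + l1norm (Q - Q') / 2).
  rewrite ler_pM2l //.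
  have {1}-> : Q - Q' = (Q *m (1%:M + H) - Q' *m (1%:M + H)) - (Q - Q') *m H.
    by rewrite -mulmxBl mulmxDr mulmx1 addrK.
  apply: le_trans (l1normD _ _) _; rewrite l1normN; apply: lerD => //.
  apply: le_trans (l1normM _ _) _; apply: ler_wpM2l H2; exact: l1norm_ge0.
rewrite mulrDr mulrCA divff ?pnatr_eq0 // mulr1.
by rewrite {1}mulr_natl mulr2n lerD2r.
Qed.

(* For a maximal family W_a of unitaries that are 1/q-separated modulo H, the
   products W_a t_b (1 + H_c), with t_b packed in H and H_c in the Hermitian
   grid, are separated in the matrix space of real dimension 2 D^2. *)
Lemma covers_unitary_mod (H : 'M[C]_D -> Prop) (J : finType) :
  (forall t, H t -> t \is unitarymx) ->
  (forall t u, H t -> H u -> H (t *m u^t*)) ->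
  packs J H -> (#|J| <= D * D)%N ->
  covers (D * D - #|J|) (@unitary C D) H.
Proof.
move=> Hu Hdiv [kap packJ] leJ.
have [K0 pub] := packing_upper_bound R D (D * D * D.+1)%N.
(* At scale 1/(K1 q) the constant must absorb 2 D^2 (D + 1) from [polar_separation] times twice the
   grid scale 8 (D + 1)^2, and also 2 D^2 times the packing constant of H. *)
pose K1 := (32 * (D.+1 * D.+1 * D.+1 * D.+1 * D.+1 * D.+1) * kap.+1)%N.
have K1_gt0 : (0 < K1)%N by [].
have le_K1 : (2 * (D * D) * kap.+1 <= K1)%N.
  by rewrite -[(D * D)%N]muln1 -[(D * D * 1)%N]muln1 -[(D * D * 1 * 1)%N]muln1
             -[(D * D * 1 * 1 * 1)%N]muln1 /K1 !leq_mul.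
exists (K0 * K1 ^ (2 * (D * D)) + D * D + 1)%N => q q0.
pose near (W U : 'M[C]_D) := exists2 t, H t & l1norm (U - W *m t) <= q%:R^-1.
(* The net is read off first; the size bound for separated families comes after it. *)
have [|s [sz us cov]] := @maximal_separated _ (0 : 'M[C]_D) (@unitary C D) near
    (K0 * K1 ^ (2 * (D * D)) * q ^ (D * D - #|J|))%N; last first.
  exists s; split.
  - by apply: leq_trans sz _; rewrite leq_mul2r -addnA leq_addr orbT.
  - move=> W /us uW; apply: le_trans (l1norm_unitary uW) _.
    by rewrite ler_nat; apply: leq_trans (leq_addl _ _) (leq_addr _ _).
  move=> X uX; have [W Ws [t Ht le_q]] := cov X uX.
  exists W, t; split=> //; apply: le_trans le_q _.
  by rewrite ler_peMl ?invr_ge0 ?ler0n // ler1n addn1.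
move=> s us sep; have [t [Ht tinj]] := packJ q q0.
pose I := ('I_(size s) * {ffun J -> 'I_q} * {ffun 'I_D * 'I_D -> 'I_q})%type.
pose Q (i : I) := s`_i.1.1 *m t i.1.2.
pose A (i : I) : 'M[C]_D := Q i *m (1%:M + herm_grid C i.2).
have us_nth (i : 'I_(size s)) : s`_i \is unitarymx by apply: us; apply: mem_nth.
have uQ i : Q i \is unitarymx by apply: mul_unitarymx; [apply: us_nth | apply: Hu].
have Kq0 : (0 < K1 * q)%N by rewrite muln_gt0 q0 K1_gt0.
have scale (m p : nat) : (0 < p)%N -> (m * p <= K1)%N ->
    m%:R * (K1 * q)%:R^-1 <= (p * q)%:R^-1 :> C.
  move=> p0 mp; rewrite ler_pdivrMr ?ltr0n // mulrC.
  rewrite ler_pdivlMr ?ltr0n ?muln_gt0 ?p0 //.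
  by rewrite -natrM ler_nat mulnA leq_mul2r mp orbT.
(* The three labels are recovered in turn: c from the Gram matrix, then i from the separation modulo
   H, then b from the packing of H. *)
have Ainj i j : l1norm (A i - A j) <= (K1 * q)%:R^-1 -> i = j.
  move: i j => [[i b] c] [[i' b'] c'] le_A.
  have cc' : c = c'.
    apply: (herm_grid_inj (C := C) q0).
    have := polar_separation (uQ (i, b, c)) (uQ (i', b', c')) (herm_grid_adj C c)
      (herm_grid_adj C c') (herm_grid_le C q0 c) (herm_grid_le C q0 c') le_A.
    move/le_lt_trans; apply.
    apply: le_lt_trans (scale _ (16 * D.+1 * D.+1)%N _ _) _ => //.
      rewrite (_ : _ * _ = 32 * (D * D * D.+1 * D.+1 * D.+1 * 1) * 1)%N; last by ring.
      by rewrite !leq_mul.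
    rewrite ltf_pV2 ?posrE ?ltr0n ?muln_gt0 ?q0 // ltr_nat ltn_pmul2r //.
    by rewrite !ltn_pmul2r.
  subst c'.
  have le_Q : l1norm (Q (i, b, c) - Q (i', b', c)) <= 2 * (K1 * q)%:R^-1.
    exact: unitary_separation (herm_grid_le C q0 c) le_A.
  have ii' : i = i'.
    have aux (k k' : 'I_(size s)) x x' : (k < k')%N ->
        l1norm (Q (k, x, c) - Q (k', x', c)) <= 2 * (K1 * q)%:R^-1 -> False.
      move=> kk' le_Q'; apply: (sep k k'); first by rewrite kk' ltn_ord.
      exists (t x *m (t x')^t*); first exact: Hdiv.
      have -> : s`_k' - s`_k *m (t x *m (t x')^t*) =
          (Q (k', x', c) - Q (k, x, c)) *m (t x')^t*.
        by rewrite mulmxBl mulmxA mulmxtVK ?Hu.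
      apply: le_trans (l1normM _ _) _; rewrite l1norm_adj l1normB.
      apply: le_trans (_ : (2 * (D * D))%:R * (K1 * q)%:R^-1 <= _).
        rewrite natrM mulrAC; apply: ler_pM; rewrite ?l1norm_ge0 //.
        exact/l1norm_unitary/Hu.
      have := scale (2 * (D * D))%N 1%N; rewrite mul1n; apply=> //.
      by rewrite muln1; apply: leq_trans le_K1; apply: leq_pmulr.
    apply: val_inj; case: (ltngtP i i') => //= [lt|lt]; exfalso.
      exact: aux lt le_Q.
    by apply: aux lt _; rewrite l1normB; apply: le_Q.
  subst i'; congr (_, _, _); apply: tinj.
  have -> : t b - t b' = (s`_i)^t* *m (Q (i, b, c) - Q (i, b', c)).
    by rewrite mulmxBr !mulmxA unitary_adj // !mul1mx.
  apply: le_trans (l1normM _ _) _; rewrite l1norm_adj.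
  apply: le_trans (_ : (2 * (D * D))%:R * (K1 * q)%:R^-1 <= _).
    rewrite natrM mulrAC mulrC; apply: ler_pM; rewrite ?l1norm_ge0 //.
    exact/l1norm_unitary.
  exact: scale.
have Abnd i : l1norm (A i) <= (D * D * D.+1)%:R.
  apply: le_trans (l1normM _ _) _; rewrite natrM.
  apply: ler_pM; rewrite ?l1norm_ge0 ?l1norm_unitary //.
  apply: le_trans (l1normD _ _) _; rewrite l1norm1 -natr1 lerD2l.
  by apply: le_trans (herm_grid_le C q0 _) _; rewrite invf_le1 ?ler1n.
have := pub _ Kq0 I A Abnd Ainj.
rewrite !card_prod !card_ffun !card_prod !card_ord => cnt.
(* The count reads [size s] * q^[#|J|] * q^(D^2) <= K0 (K1 q)^(2 D^2). Cancelling this power of q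
   leaves the exponent D^2 - [#|J|]. *)
have qn0 : (0 < q ^ (#|J| + D * D))%N by rewrite expn_gt0 q0.
rewrite -(leq_pmul2r qn0) expnD mulnA; apply: leq_trans cnt _.
rewrite expnMn -!mulnA -!expnD.
by rewrite addnA subnK // addnn mul2n.
Qed.

End SubgroupNet.

(** * Composition of nets and comparison with packings *)

Section CoversCalculus.
Variables (C : numClosedFieldType) (D : nat).
Implicit Types (S H : 'M[C]_D -> Prop) (e : nat).

Lemma covers_sub e S S' H H' : (forall X, S' X -> S X) ->
  (forall h, H h -> H' h) -> covers e S H -> covers e S' H'.
Proof.
move=> SS' HH' [K cK]; exists K => q /cK[s [sz bs cs]]; exists s; split=> //.
by move=> X /SS'/cs[W [h [Ws /HH' Hh' le_X]]]; exists W, h.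
Qed.

Lemma covers_refl S : covers 0 S S.
Proof.
exists D.+1 => q _; exists [:: 1%:M]; split=> //.
  by move=> W; rewrite inE => /eqP->; rewrite l1norm1 ler_nat.
move=> X SX; exists 1%:M, X; split=> //; first by rewrite inE.
by rewrite mul1mx subrr -(scale0r 0) l1normZ normr0 mul0r divr_ge0.
Qed.

(** The products W W' form a net: the error of the second net is multiplied by the norm of W, which
    [covers] keeps bounded independently of q. *)
Lemma covers_trans e e' S H H' :
  covers e S H -> covers e' H H' -> covers (e + e') S H'.
Proof.
move=> [K cK] [K' cK']; exists (K + K * K')%N => q q0.
have [s [sz bs cs]] := cK q q0; have [s' [sz' bs' cs']] := cK' q q0.
exists [seq W *m W' | W <- s, W' <- s']; split.
- rewrite size_allpairs; apply: leq_trans (leq_mul sz sz') _.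
  by rewrite mulnACA -expnD leq_mul2r leq_addl orbT.
- move=> _ /allpairsP[[W W'] /= [/bs bW /bs' bW' ->]].
  apply: le_trans (l1normM _ _) _; apply: le_trans (ler_pM _ _ bW bW') _;
    rewrite ?l1norm_ge0 //.
  by rewrite -natrM ler_nat leq_addl.
move=> X /cs[W [h [Ws /cs'[W' [h' [Ws' Hh' le_h]]] le_X]]].
exists (W *m W'), h'; split=> //; first by apply/allpairsP; exists (W, W').
have -> : X - W *m W' *m h' = (X - W *m h) + W *m (h - W' *m h').
  by rewrite mulmxBr mulmxA addrA subrK.
apply: le_trans (l1normD _ _) _; rewrite natrD mulrDl; apply: lerD => //.
apply: le_trans (l1normM _ _) _; rewrite natrM -mulrA.
by apply: ler_pM; rewrite ?l1norm_ge0 ?bs.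
Qed.

(** Serves to add one gate to a circuit. If Y is close to W h and h B = G h', then Y B is close to
    (W G) h'. A two-qudit gate uses B = G; a single-qudit gate uses G = 1 and is absorbed into
    h'. *)
Lemma covers_mulr e S S' H H' (G : 'M[C]_D) (g b : nat) :
  l1norm G <= g%:R ->
  (forall X, S' X -> exists Y B, [/\ S Y, X = Y *m B, l1norm B <= b%:R
     & forall h, H h -> exists2 h', H' h' & h *m B = G *m h']) ->
  covers e S H -> covers e S' H'.
Proof.
move=> bG S'P [K cK]; exists (K * (g + b).+1)%N => q q0.
have [s [sz bs cs]] := cK q q0.
exists [seq W *m G | W <- s]; split.
- rewrite size_map; apply: leq_trans sz _.
  by rewrite leq_mul2r leq_pmulr ?orbT.
- move=> _ /mapP[W /bs bW ->]; apply: le_trans (l1normM _ _) _.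
  apply: le_trans (ler_pM _ _ bW bG) _; rewrite ?l1norm_ge0 //.
  by rewrite -natrM ler_nat leq_mul2l -addnS leq_addr orbT.
move=> X /S'P[Y [B [/cs[W [h [Ws Hh le_Y]]] -> bB HB]]].
have [h' Hh' hE] := HB h Hh; exists (W *m G), h'; split=> //.
  exact: map_f.
rewrite -mulmxA -hE mulmxA -mulmxBl; apply: le_trans (l1normM _ _) _.
apply: le_trans (ler_pM _ _ le_Y bB) _; rewrite ?l1norm_ge0 //.
rewrite mulrAC -natrM ler_wpM2r ?invr_ge0 ?ler0n // ler_nat leq_mul2l.
by rewrite -addSn leq_addl orbT.
Qed.

Lemma covers_packs_le (J : finType) e S :
  packs J S -> covers e S (eq 1%:M) -> (#|J| <= e)%N.
Proof.
move=> [kap packJ] [K cK]; rewrite leqNgt; apply/negP => lt_e.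
(* M makes twice the net radius at most the packing distance, so packed points have distinct net
   points. As q' exceeds K M^e, the q'^(e+1) or more packed points outnumber the net, of size at
   most K (M q')^e. *)
pose M := (2 * K * kap.+1).+1; pose q' := (K * M ^ e).+1.
have [t [St tinj]] := packJ q' isT.
have q0 : (0 < M * q')%N by [].
have [s [sz _ cs]] := cK _ q0.
have /choice[w wP] : forall b, exists W,
    W \in s /\ l1norm (t b - W) <= K%:R / (M * q')%:R.
  move=> b; have [W [_ [Ws <- le_W]]] := cs _ (St b).
  by exists W; rewrite mulmx1 in le_W.
have winj : injective w.
  move=> b b' e_w; apply: tinj.
  have -> : t b - t b' = (t b - w b) - (t b' - w b').
    by rewrite e_w opprB addrA subrK.
  apply: le_trans (l1normD _ _) _; rewrite l1normN.
  apply: le_trans (lerD (wP b).2 (wP b').2) _.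
  rewrite -mulr2n -mulrnAl -mulr_natl -natrM.
  rewrite ler_pdivrMr ?ltr0n // mulrC ler_pdivlMr ?ltr0n //.
  by rewrite -natrM ler_nat; nia.
have : (#|{ffun J -> 'I_q'}| <= size s)%N.
  rewrite cardE -(size_map w); apply: uniq_leq_size.
    by rewrite map_inj_uniq // enum_uniq.
  by move=> _ /mapP[b _ ->]; have [] := wP b.
rewrite card_ffun card_ord => /leq_trans/(_ sz).
rewrite expnMn mulnA leqNgt => /negP; apply.
apply: (@leq_trans (q' ^ e.+1)).
  by rewrite expnS ltn_pmul2r ?expn_gt0.
by rewrite leq_pexp2l.
Qed.

End CoversCalculus.

(** * Tensor products, local unitaries and controlled gates *)

Section Tensor.
Variables (C : numClosedFieldType) (d n : nat).
Local Notation M := 'M[C]_d.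
Local Notation N := (qdim d n).
Implicit Types (A B : 'I_n -> M) (i j : 'I_n).

Lemma eq_tensor A B : A =1 B -> tensor_op A = tensor_op B.
Proof.
by move=> AB; apply/matrixP => x y; rewrite !mxE; apply: eq_bigr => k _; rewrite AB.
Qed.

Lemma tensorM A B : tensor_op A *m tensor_op B = tensor_op (fun k => A k *m B k).
Proof.
apply/matrixP => x y; rewrite !mxE.
under [RHS]eq_bigr => k _ do rewrite mxE.
rewrite bigA_distr_bigA /= [RHS](reindex (@ket d n)) /=; last first.
  exact/onW_bij/enum_val_bij.
by apply: eq_bigr => z _; rewrite !mxE -big_split.
Qed.

Lemma delta_ket (x y : 'I_N) :
  \prod_(k < n) (1%:M : M) (ket x k) (ket y k) = (x == y)%:R.
Proof.
case: (eqVneq x y) => [->|xy]; first by rewrite big1 // => k _; rewrite mxE eqxx.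
have [k xyk] : exists k, ket x k != ket y k.
  apply/existsP; rewrite -negb_forall; apply: contra xy => /forallP xy.
  by apply/eqP/enum_val_inj/ffunP => k; apply/eqP.
by rewrite (bigD1 k) //= mxE (negbTE xyk) mul0r.
Qed.

Lemma tensor1 : tensor_op (fun=> 1%:M) = 1%:M :> 'M[C]_N.
Proof. by apply/matrixP => x y; rewrite !mxE delta_ket. Qed.

Lemma tensor_unitary A : (forall k, A k \is unitarymx) -> tensor_op A \is unitarymx.
Proof.
move=> uA; apply/unitarymxP.
have -> : (tensor_op A)^t* = tensor_op (fun k => (A k)^t*).
  apply/matrixP => x y; rewrite !mxE rmorph_prod.
  by apply: eq_bigr => k _; rewrite !mxE.
rewrite tensorM -tensor1; apply: eq_tensor => k; exact/unitarymxP.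
Qed.

Definition upd A i (X : M) : 'I_n -> M := fun k => if k == i then X else A k.

Lemma on_factor_tensor i X A : on_factor i X *m tensor_op A =
  tensor_op (upd A i (X *m A i)).
Proof.
rewrite tensorM; apply: eq_tensor => k; rewrite /upd.
by case: eqVneq => [->|_] //; rewrite mul1mx.
Qed.

Lemma tensor_on_factor i X A : tensor_op A *m on_factor i X =
  tensor_op (upd A i (A i *m X)).
Proof.
rewrite tensorM; apply: eq_tensor => k; rewrite /upd.
by case: eqVneq => [->|_] //; rewrite mulmx1.
Qed.

Lemma on_factorE i (X : M) (x y : 'I_N) : on_factor i X x y =
  X (ket x i) (ket y i) * \prod_(k < n | k != i) (1%:M : M) (ket x k) (ket y k).
Proof.
rewrite mxE (bigD1 i) //= eqxx; congr (_ * _).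
by apply: eq_bigr => k /negbTE->.
Qed.

Lemma on_factorB i (X Y : M) :
  on_factor i (X - Y) = on_factor i X - on_factor i Y :> 'M[C]_N.
Proof.
by apply/matrixP => x y; rewrite [RHS]mxE [X in _ = _ + X]mxE !on_factorE 2!mxE mulrBl.
Qed.

Lemma on_factorM i (X Y : M) :
  on_factor i X *m on_factor i Y = on_factor i (X *m Y) :> 'M[C]_N.
Proof.
rewrite on_factor_tensor; apply: eq_tensor => k; rewrite /upd eqxx.
by case: eqP.
Qed.

Lemma on_factor1 i : on_factor i (1%:M : M) = 1%:M :> 'M[C]_N.
Proof. by rewrite -tensor1; apply: eq_tensor => k; case: eqP. Qed.

Lemma norm_on_factor_entry i (X : M) (x y : 'I_N) :
  `|on_factor i X x y| <= `|X (ket x i) (ket y i)|.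
Proof.
rewrite on_factorE normrM ler_piMr // normr_prod prodr_ile1 // => k _.
by rewrite normr_ge0 mxE normr_nat lern1 leq_b1.
Qed.

Lemma l1norm_on_factor i (X : M) :
  l1norm (on_factor i X : 'M[C]_N) <= (N * N)%:R * l1norm X.
Proof.
apply: l1norm_le_entries => x y; apply: le_trans (norm_on_factor_entry _ _ _ _) _.
exact: le_norm_l1norm.
Qed.

Definition local_op (F : 'I_n -> M -> Prop) (X : 'M[C]_N) : Prop :=
  exists2 A, (forall k, F k (A k)) & X = tensor_op A.

(** Factor i is split off as a left multiplier and approximated by the net of [F i]. The other
    factors stay in the part on the right, whose norm is bounded by unitarity. *)
Lemma covers_factor e (F : 'I_n -> M -> Prop) i (T : M -> Prop) :
  (forall k X, F k X -> X \is unitarymx) -> covers e (F i) T ->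
  covers e (local_op F) (local_op (fun k => if k == i then T else F k)).
Proof.
move=> Fu [K cK]; exists (N * N * K * (N * N) + K)%N => q q0.
have [s [sz bs cs]] := cK q q0.
exists [seq on_factor i W | W <- s]; split.
- rewrite size_map; apply: leq_trans sz _.
  by rewrite leq_mul2r leq_addl orbT.
- move=> _ /mapP[W /bs bW ->]; apply: le_trans (l1norm_on_factor _ _) _.
  apply: le_trans (_ : (N * N * K)%:R <= _).
    by rewrite (natrM _ (N * N)) ler_wpM2l.
  case: (posnP N) => [->//|N0]; rewrite ler_nat.
  by apply: leq_trans (leq_addr _ _); rewrite leq_pmulr // muln_gt0 N0.
move=> _ [A FA ->]; have [W [t [Ws Tt le_t]]] := cs _ (FA i).
exists (on_factor i W), (tensor_op (upd A i t)); split.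
- exact: map_f.
- by exists (upd A i t) => // k; rewrite /upd; case: eqVneq => [|_] //; apply: FA.
have -> : tensor_op (upd A i t) = on_factor i t *m tensor_op (upd A i 1%:M).
  rewrite on_factor_tensor; apply: eq_tensor => k; rewrite /upd eqxx mulmx1.
  by case: eqP.
have -> : tensor_op A = on_factor i (A i) *m tensor_op (upd A i 1%:M).
  rewrite on_factor_tensor; apply: eq_tensor => k; rewrite /upd eqxx mulmx1.
  by case: eqP => // ->.
rewrite mulmxA on_factorM -mulmxBl -on_factorB.
apply: le_trans (l1normM _ _) _.
apply: (@le_trans _ _ ((N * N)%:R * (K%:R / q%:R) * (N * N)%:R)).
  apply: ler_pM; rewrite ?l1norm_ge0 //.
    by apply: le_trans (l1norm_on_factor _ _) _; rewrite ler_wpM2l.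
  apply/l1norm_unitary/tensor_unitary => k; rewrite /upd.
  by case: eqP => _; [exact: unitarymx1 | apply: Fu (FA k)].
rewrite mulrA mulrAC -!natrM ler_wpM2r ?invr_ge0 ?ler0n // ler_nat.
exact: leq_addr.
Qed.

Lemma covers_factors e (T : M -> Prop) (r : seq 'I_n) : uniq r ->
  (forall t, T t -> t \is unitarymx) -> covers e (@unitary C d) T ->
  covers (size r * e) (local_op (fun=> @unitary C d))
    (local_op (fun k => if k \in r then T else @unitary C d)).
Proof.
move=> ur Tu cT; elim: r ur => [|i r IHr] /=; first by move=> _; apply: covers_refl.
move=> /andP[ir /IHr cr]; rewrite mulSn addnC; apply: covers_trans cr _.
have : covers e (local_op (fun k => if k \in r then T else @unitary C d)) (local_op
    (fun k => if k == i then T else if k \in r then T else @unitary C d)).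
  apply: covers_factor => [k X|]; first by case: ifP => // _ /Tu.
  by rewrite (negbTE ir).
apply: covers_sub => // X [A FA ->]; exists A => // k.
by move: (FA k); rewrite inE; case: eqP.
Qed.

(** G is the sum over a of the projection |a><a| on factor i tensored with f a on factor j, and the
    tensor product A commutes with each summand factor by factor. *)
Lemma controlled_gate_comm (G : 'M[C]_N) i j (f : 'I_d -> M) A : i != j ->
  (forall x y, G x y = on_factor j (f (ket y i)) x y) ->
  (forall a, A i *m delta_mx a a = delta_mx a a *m A i) ->
  (forall a, A j *m f a = f a *m A j) ->
  tensor_op A *m G = G *m tensor_op A.
Proof.
move=> ij GE Ai Aj.
pose P a : 'I_n -> M := upd (upd (fun=> 1%:M) j (f a)) i (delta_mx a a).
have -> : G = \sum_a tensor_op (P a).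
  apply/matrixP => x y; rewrite GE summxE (bigD1 (ket y i)) //= [X in _ + X]big1.
    rewrite addr0 !mxE; apply: eq_bigr => k _; rewrite /P /upd.
    case: (eqVneq k i) => [->|_]; last by [].
    by rewrite (negbTE ij) !mxE eqxx andbT.
  move=> a ya; rewrite mxE (bigD1 i) //= /P /upd eqxx mxE.
  by rewrite [ket y i == a]eq_sym (negbTE ya) andbF mul0r.
rewrite mulmx_sumr mulmx_suml; apply: eq_bigr => a _; rewrite !tensorM.
apply: eq_tensor => k; rewrite /P /upd.
case: eqVneq => [->|_]; first exact: Ai.
by case: eqVneq => [->|_]; [apply: Aj | rewrite mul1mx mulmx1].
Qed.

End Tensor.

(** * Tori and phases in the unitary group *)

Section Tori.
Variables (C : numClosedFieldType) (d : nat).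

(** For unitary V, the maximal torus of unitaries diagonal in the orthonormal basis of columns of
    [V^t*]. *)
Definition torus (V : 'M[C]_d) (t : 'M[C]_d) : Prop :=
  exists2 z : 'rV[C]_d, (forall j, `|z 0 j| = 1) & t = V^t* *m diag_mx z *m V.

Definition phase (t : 'M[C]_d) : Prop := exists2 z : C, `|z| = 1 & t = z%:M.

Lemma phase_unitary t : phase t -> t \is unitarymx.
Proof.
move=> [z z1 ->]; apply/unitarymxP.
by rewrite tr_scalar_mx map_scalar_mx -scalar_mxM /= -normCK z1 expr1n.
Qed.

Lemma phase_div t u : phase t -> phase u -> phase (t *m u^t*).
Proof.
move=> [z z1 ->] [w w1 ->]; exists (z * w^*).
  by rewrite normrM norm_conjC z1 w1 mulr1.
by rewrite tr_scalar_mx map_scalar_mx -scalar_mxM.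
Qed.

Lemma packs_phase : (0 < d)%N -> packs unit phase.
Proof.
(* The successor of 3 is the constant 4 of [circle_pt_inj]. *)
move=> d0; exists 3 => q q0.
exists (fun b : {ffun unit -> 'I_q} => (circle_pt C q (b tt))%:M); split=> [b|b b' le_bb'].
  by exists (circle_pt C q (b tt)) => //; apply: circle_pt_norm.
apply/ffunP => -[]; apply: (circle_pt_inj (C := C) q0); apply: le_trans le_bb'.
have := le_norm_l1norm ((circle_pt C q (b tt))%:M - (circle_pt C q (b' tt))%:M)
  (Ordinal d0) (Ordinal d0).
by rewrite !mxE eqxx.
Qed.

Variable V : 'M[C]_d.
Hypothesis V_unitary : V \is unitarymx.

Let diag_unitary (z : 'rV[C]_d) : (forall j, `|z 0 j| = 1) -> diag_mx z \is unitarymx.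
Proof.
move=> z1; apply/unitarymxP; rewrite tr_diag_mx map_diag_mx mulmx_diag.
apply/matrixP => i j; rewrite !mxE; case: eqVneq => // _.
by rewrite -normCK z1 expr1n.
Qed.

Lemma torus_unitary t : torus V t -> t \is unitarymx.
Proof.
by move=> [z z1 ->]; rewrite !mul_unitarymx ?trmxC_unitary ?diag_unitary.
Qed.

Lemma torus_div t u : torus V t -> torus V u -> torus V (t *m u^t*).
Proof.
move=> [z z1 ->] [w w1 ->]; exists (\row_j (z 0 j * (w 0 j)^*)).
  by move=> j; rewrite mxE normrM norm_conjC z1 w1 mulr1.
rewrite !trmxCM trmxCK !mulmxA mulmxtVK //; congr (_ *m _).
rewrite -!mulmxA; congr (_ *m _); rewrite tr_diag_mx map_diag_mx mulmx_diag.
by congr diag_mx; apply/rowP => j; rewrite !mxE.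
Qed.

Lemma packs_torus : packs 'I_d (torus V).
Proof.
(* Undoing the conjugation by V costs a factor d^2 for each of V and [V^t*]; the 4 comes from
   [circle_pt_inj]. *)
exists (4 * (d * d) * (d * d))%N => q q0.
pose z (b : {ffun 'I_d -> 'I_q}) : 'rV[C]_d := \row_j circle_pt C q (b j).
exists (fun b => V^t* *m diag_mx (z b) *m V); split=> [b|b b' le_bb'].
  by exists (z b) => // j; rewrite mxE circle_pt_norm.
apply/ffunP => j; apply: (circle_pt_inj (C := C) q0).
have := le_norm_l1norm (diag_mx (z b) - diag_mx (z b')) j j.
rewrite !mxE eqxx => /le_trans; apply.
have -> : diag_mx (z b) - diag_mx (z b') = V *m (V^t* *m diag_mx (z b) *m V -
    V^t* *m diag_mx (z b') *m V) *m V^t*.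
  have VV := unitarymxP V_unitary.
  by rewrite mulmxBr mulmxBl !mulmxA VV !mul1mx -!mulmxA VV !mulmx1.
apply: le_trans (l1normM _ _) _; rewrite l1norm_adj.
apply: (@le_trans _ _ ((d * d)%:R * (((4 * (d * d) * (d * d)).+1 * q)%:R^-1) * (d * d)%:R)).
  apply: ler_pM; rewrite ?l1norm_ge0 ?l1norm_unitary //.
  apply: le_trans (l1normM _ _) _.
  by apply: ler_pM; rewrite ?l1norm_ge0 ?l1norm_unitary.
rewrite mulrAC -natrM ler_pdivrMr ?ltr0n ?muln_gt0 // mulrC.
rewrite ler_pdivlMr ?ltr0n ?muln_gt0 // -natrM ler_nat.
rewrite mulnA leq_mul2r mulnC mulnA; apply/orP; right; exact: leqnSn.
Qed.

Lemma torus_comm t (z : 'rV[C]_d) : torus V t ->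
  t *m (V^t* *m diag_mx z *m V) = V^t* *m diag_mx z *m V *m t.
Proof.
move=> [w _ ->]; rewrite !mulmxA !mulmxtVK //.
by rewrite -!(mulmxA (V^t*)) diag_mxC.
Qed.

End Tori.

(** * Unitarity of the shift and diagonalization of unitaries *)

Section Shift.
Variables (C : numClosedFieldType) (d : nat).

Lemma shift_unitary : shift_op C d \is unitarymx.
Proof.
apply/unitarymxP/matrixP => a b; rewrite !mxE.
under eq_bigr => c _ do rewrite !mxE rmorph_nat -natrM mulnb.
case: (eqVneq a b) => [<-|ab].
  rewrite (bigD1 (ord_pred a)) //= ord_predK eqxx big1 ?addr0 // => c.
  by rewrite andbb; case: (eqVneq a) => // ->; rewrite ordSK eqxx.
rewrite big1 // => c _; case: eqVneq => //= <-.
by rewrite eq_sym (negbTE ab).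
Qed.

Lemma unitary_diagonalizable (X : 'M[C]_d) : X \is unitarymx ->
  exists2 V : 'M[C]_d, V \is unitarymx & exists z, X = V^t* *m diag_mx z *m V.
Proof.
move=> uX; have /orthomx_spectralP XE : X \is normalmx.
  by apply/normalmxP; rewrite (unitarymxP uX) unitary_adj.
exists (spectralmx X); first exact: spectral_unitarymx.
by exists (spectral_diag X); rewrite -invmx_unitary ?spectral_unitarymx.
Qed.

End Shift.

(** * Nets of U(d) modulo a torus, the phases and the trivial group *)

Section UnitaryNets.
Variables (R : realType) (d : nat).
Local Notation C := R[i].
Hypothesis d_gt0 : (0 < d)%N.

Lemma covers_torus U : U \is unitarymx ->
  covers (d * d - d) (@unitary C d) (torus U).
Proof.
move=> uU; rewrite -[X in (_ - X)%N](card_ord d); apply: covers_unitary_mod.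
- by move=> t; apply: torus_unitary.
- by move=> t u; apply: torus_div.
- exact: packs_torus.
by rewrite card_ord leq_pmull.
Qed.

Lemma covers_phase : covers (d * d - 1) (@unitary C d) (@phase C d).
Proof.
rewrite -card_unit; apply: covers_unitary_mod.
- by move=> t; apply: phase_unitary.
- by move=> t u; apply: phase_div.
- exact: packs_phase.
by rewrite card_unit muln_gt0 d_gt0.
Qed.

Lemma covers_unitary : covers (d * d) (@unitary C d) (eq 1%:M).
Proof.
(* The trivial group has dimension 0, hence is packed by the empty type. *)
rewrite -[X in covers X](subn0 (d * d)) -card_void; apply: covers_unitary_mod.
- by move=> t <-; apply: unitarymx1.
- by move=> t u <- <-; rewrite trmxC1 mulmx1.
- by exists 0 => q q0; exists (fun=> 1%:M); split=> // b b' _; apply/ffunP; case.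
by rewrite card_void.
Qed.

End UnitaryNets.

(** * Metric dimension of the operators reached by a circuit *)

Section CircuitEntropy.
Variables (C : numClosedFieldType) (d n : nat).
Local Notation N := (qdim d n).
Variables (G : 'I_n -> 'I_n -> 'M[C]_N) (f : 'I_d -> 'M[C]_d) (V : 'M[C]_d).
Hypothesis GE : forall i j x y, G i j x y = on_factor j (f (ket y i)) x y.
Hypothesis f_unitary : forall a, f a \is unitarymx.
Hypothesis V_unitary : V \is unitarymx.
Hypothesis f_torus : forall a t, torus V t -> t *m f a = f a *m t.
Hypothesis cov_torus : forall U : 'M[C]_d, U \is unitarymx ->
  covers (d * d - d) (@unitary C d) (torus U).
Hypothesis cov_phase : covers (d * d - 1) (@unitary C d) (@phase C d).
Hypothesis cov_unitary : covers (d * d) (@unitary C d) (eq 1%:M).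

Definition circuit_image c X := exists2 W : nat -> 'M[C]_d,
  (forall k, W k \is unitarymx) & X = circuit_op G c W.
Let local_unitary := local_op (fun _ : 'I_n => @unitary C d).

Lemma circuit_imageI c W : (forall k, W k \is unitarymx) ->
  circuit_image c (circuit_op G c W).
Proof. by move=> uW; exists W. Qed.

Lemma gate_entry_le i j : l1norm (G i j) <= (N * N)%:R.
Proof.
rewrite -[leRHS]mulr1; apply: l1norm_le_entries => x y; rewrite GE.
exact: le_trans (norm_on_factor_entry j _ x y)
                (norm_unitary_entry _ _ (f_unitary _)).
Qed.

(* Only 2 (d^2 - d) of the parameters of the two local unitaries preceding a
   controlled gate matter: a diagonal unitary on the control and an element of
   the torus of f on the target can be moved past the gate. *)
Lemma covers_circuit c :
  covers (two_qudit_count c * (2 * (d * d - d))) (circuit_image c) local_unitary.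
Proof.
elim: c => [|[i|i j ij] c IHc].
- apply: covers_sub (covers_refl local_unitary) => // X [W _ ->].
  exists (fun=> 1%:M); last by rewrite tensor1.
  by move=> k; apply: unitarymx1.
(* A single-qudit gate is absorbed into the local unitary on its left, so the exponent does not
   grow. *)
- apply: (covers_mulr (G := 1%:M) (g := N) (b := N * N) _ _ IHc).
    by rewrite l1norm1.
  move=> X [W uW ->]; exists (circuit_op G c (fun k => W k.+1)), (on_factor i (W 0%N)).
  split.
  + exact: (circuit_imageI c (fun k => uW k.+1)).
  + exact: erefl.
  + apply/l1norm_unitary/tensor_unitary => k.
    by case: eqP => _; [exact: uW | exact: unitarymx1].
  move=> _ [A uA ->]; exists (tensor_op (upd A i (A i *m W 0%N))).
    exists (upd A i (A i *m W 0%N)) => // k; rewrite /upd.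
    by case: eqP => _; [apply: mul_unitarymx; [apply: uA | apply: uW] | apply: uA].
  by rewrite mul1mx tensor_on_factor.
(* [T1] makes the control diagonal in the computational basis, and [T2] also puts the target in the
   torus of V. Each reduction costs d^2 - d; since i and j differ, the target is still unrestricted
   in [T1]. *)
pose T1 := fun k => if k == i then torus (1%:M : 'M[C]_d) else @unitary C d.
pose T2 := fun k => if k == j then torus V else T1 k.
have T1u k X : T1 k X -> X \is unitarymx.
  by rewrite /T1; case: eqP => // _; apply: torus_unitary; apply: unitarymx1.
have T2u k X : T2 k X -> X \is unitarymx.
  by rewrite /T2; case: eqP => [_|_ /T1u //]; apply: torus_unitary.
have cT : covers (2 * (d * d - d)) local_unitary (local_op T2).
  rewrite mul2n -addnn; apply: (@covers_trans _ _ _ _ _ (local_op T1)).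
    by apply: covers_factor => //; apply: cov_torus; apply: unitarymx1.
  apply: covers_factor => //; rewrite /T1 eq_sym (negbTE ij).
  exact: cov_torus.
rewrite /two_qudit_count /= -/(two_qudit_count c) add1n mulSn addnC.
apply: (covers_mulr (gate_entry_le i j) _ (covers_trans IHc cT)).
move=> X [W uW ->]; exists (circuit_op G c (fun k => W k.+1)), (G i j); split.
+ exact: (circuit_imageI c (fun k => uW k.+1)).
+ exact: erefl.
+ exact: gate_entry_le.
move=> _ [A T2A ->]; exists (tensor_op A); first by exists A => // k; apply: T2u (T2A k).
apply: (controlled_gate_comm ij (GE i j)) => a.
  have := T2A i; rewrite /T2 /T1 (negbTE ij) eqxx => -[z _ ->].
  have -> : delta_mx a a = diag_mx (delta_mx 0 a) :> 'M[C]_d.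
    by apply/matrixP => u v; rewrite !mxE eqxx; case: (eqVneq u v) => [<-|uv] /=;
       rewrite ?andbb // mulr0n; case: eqVneq => //= <-; rewrite eq_sym (negbTE uv).
  by rewrite trmxC1 mul1mx mulmx1 diag_mxC.
by apply: f_torus; have := T2A j; rewrite /T2 eqxx.
Qed.

(** All factors except i0 are covered modulo phases. The leftover phases are scalars, so they can be
    collected in factor i0, the only one covered in full. *)
Lemma covers_local_unitary (i0 : 'I_n) :
  covers (n.-1 * (d * d - 1) + d * d) local_unitary (eq 1%:M).
Proof.
pose r := rem i0 (enum 'I_n).
have r_size : size r = n.-1 by rewrite size_rem ?mem_enum // size_enum_ord.
have r_uniq : uniq r by rewrite rem_uniq ?enum_uniq.
have mem_r k : (k \in r) = (k != i0).
  by rewrite mem_rem_uniq ?enum_uniq // inE mem_enum andbT.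
rewrite -r_size; apply: covers_trans (covers_factors r_uniq _ cov_phase) _.
  by move=> t; apply: phase_unitary.
pose F := fun k => if k == i0 then @unitary C d else eq (1%:M : 'M[C]_d).
have Fu k X : F k X -> X \is unitarymx.
  by rewrite /F; case: eqP => // _ <-; apply: unitarymx1.
have cF : covers (d * d) (F i0) (eq 1%:M) by rewrite /F eqxx; apply: cov_unitary.
apply: covers_sub (covers_factor Fu cF).
  move=> _ [A rA ->].
  (* At i0 the value of z is a dummy, excluded from the product [w]. *)
  have /choice[z zP] : forall k, exists z : C,
      k != i0 -> `|z| = 1 /\ A k = z%:M.
    move=> k; case: (eqVneq k i0) => [_|ki]; first by exists 0.
    by have := rA k; rewrite mem_r ki => -[z z1 ->]; exists z.
  pose w := \prod_(k < n | k != i0) z k.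
  exists (upd (fun=> 1%:M) i0 (w *: A i0)).
    move=> k; rewrite /F /upd; case: eqP => // _; apply/unitarymxP.
    have := rA i0; rewrite mem_r eqxx /= => /unitarymxP uA.
    rewrite linearZ /= map_mxZ -scalemxAl -scalemxAr uA scalerA -normCK.
    rewrite normr_prod big1 ?expr1n ?scale1r // => k' /zP[] //.
  apply/matrixP => x y; rewrite !mxE (bigD1 i0) //= [RHS](bigD1 i0) //=.
  rewrite /upd eqxx mxE [w * _]mulrC -mulrA; congr (_ * _).
  rewrite /w -big_split; apply: eq_bigr => k ki /=.
  by rewrite (negbTE ki) (zP k ki).2 !mxE mulr_natr.
move=> _ [A FA ->]; rewrite -tensor1; apply: eq_tensor => k.
by have := FA k; rewrite /F; case: eqP.
Qed.

(** Universality turns the net of the circuit image into one of the whole unitary group, whose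
    packing dimension is N^2 = d^(2n). *)
Lemma universal_two_qudit_count c : (0 < n)%N -> universal_circuit G c ->
  (d ^ (2 * n) <= two_qudit_count c * (2 * (d * d - d)) +
                  (n.-1 * (d * d - 1) + d * d))%N.
Proof.
move=> n0 univ.
have cU : covers (two_qudit_count c * (2 * (d * d - d)) +
    (n.-1 * (d * d - 1) + d * d)) (@unitary C N) (eq 1%:M).
  apply: covers_sub (covers_trans (covers_circuit c)
                       (covers_local_unitary (Ordinal n0))) => // X /univ[W [uW <-]].
  exact: (circuit_imageI c uW).
have card_N : #|{: 'I_N * 'I_N}| = (d ^ (2 * n))%N.
  rewrite card_prod card_ord.
  have -> : N = (d ^ n)%N by rewrite card_ffun !card_ord.
  by rewrite -expnD addnn -mul2n.
by rewrite -card_N; apply: covers_packs_le (@packs_unitary C N) cU.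
Qed.

End CircuitEntropy.

(** * The numerical bound and its two instances *)

Lemma ceil_bound_le (d n m : nat) : (2 <= d)%N -> (1 <= n)%N ->
  (d ^ (2 * n) <= m * (2 * (d * d - d)) + (n.-1 * (d * d - 1) + d * d))%N ->
  Num.ceil ((1 / (2 * d%:R * (d%:R - 1)))
            * (d%:R ^+ (2 * n) - n%:R * (d%:R ^+ 2 - 1) - 1) : rat) <= m%:Z.
Proof.
move=> d2 n1; rewrite -(ler_nat rat) => le_m.
have d0 : (2 : rat) <= d%:R by rewrite ler_nat.
have den0 : 0 < 2 * d%:R * (d%:R - 1) :> rat.
  by rewrite !mulr_gt0 //; lra.
rewrite ceil_le_int mul1r mulrC ler_pdivrMr // -pmulrn.
have dd0 : (0 < d * d)%N by rewrite muln_gt0 (ltnW d2).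
have ddd : (d <= d * d)%N by rewrite leq_pmull // ltnW.
move: le_m; rewrite natrX natrD !natrM natrD !natrM !natrB // !natrM.
(* This gives (n - 1)(d^2 - 1) + d^2 = n (d^2 - 1) + 1, the quantity subtracted in the bound. *)
have -> : n%:R = n.-1%:R + 1 :> rat by rewrite natr1 prednK.
by move=> le_m; lra.
Qed.

Theorem theoremV5 (R : realType) (d n : nat) (hd : (2 <= d)%N) (hn : (1 <= n)%N) :
  (forall c : circuit n,
     universal_circuit (@sum_gate R[i] d n) c ->
     Num.ceil ((1 / (2 * d%:R * (d%:R - 1)))
               * (d%:R ^+ (2 * n) - n%:R * (d%:R ^+ 2 - 1) - 1) : rat)
     <= (two_qudit_count c)%:Z) /\
  (forall c : circuit n,
     universal_circuit (@cinc_gate R[i] d n) c ->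
     Num.ceil ((1 / (2 * d%:R * (d%:R - 1)))
               * (d%:R ^+ (2 * n) - n%:R * (d%:R ^+ 2 - 1) - 1) : rat)
     <= (two_qudit_count c)%:Z).
Proof.
have d_gt0 : (0 < d)%N by apply: ltnW.
have uX := shift_unitary R[i] d.
(* The torus of an eigenbasis of X_d commutes with X_d, hence with every operator that either kind
   of gate applies to its target. *)
have [V uV [z XE]] := unitary_diagonalizable uX.
have XV t : torus V t -> t *m shift_op R[i] d = shift_op R[i] d *m t.
  by rewrite XE; apply: torus_comm.
have cT := @covers_torus R d d_gt0.
have cP := covers_phase R d_gt0.
have cU := covers_unitary R d.
split=> c univ; apply: ceil_bound_le => //.
  (* SUM applies X_d^a to the target when the control is a. *)
  apply: (universal_two_qudit_count (f := fun a => shift_op R[i] d ^+ a)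
            _ _ uV _ cT cP cU hn univ) => [i j x y|a|a t /XV tX].
  - by rewrite mxE.
  - elim: (a : nat) => [|k IHk]; first exact: unitarymx1.
    by rewrite exprS; apply: mul_unitarymx.
  - exact: (@GRing.commrX 'M[R[i]]_d t _ a tX).
(* CINC applies X_d for the control value d - 1 and the identity for all others. *)
apply: (universal_two_qudit_count
          (f := fun a => if a == d.-1 :> nat then shift_op R[i] d else 1%:M)
          _ _ uV _ cT cP cU hn univ) => [i j x y|a|a t /XV tX].
- by rewrite mxE; case: ifP; rewrite ?on_factor1.
- by case: ifP => _; [exact: uX | exact: unitarymx1].
- by case: ifP => // _; rewrite mulmx1 mul1mx.
Qed.
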